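(* Let $X,Y\in\mathrm{Conf}_n(\mathbb{R}^k)$ be two $n$-configurations in $\mathbb{R}^k$, and let $\pi\in\mathrm{Iso}(\mathbb{R}^k)$ be a fixed isometry. Then $$|\mu(X,\pi)-\mu(Y,\pi)|\leq 2W_p(X,Y).$$
   Context: Fix $n\geq2$ and $p\geq1$. $\mathrm{Conf}_n(\mathbb{R}^k)$ is the set of subsets of $n$ distinct points of $\mathbb{R}^k$; $d$ is the Euclidean distance. The $p$-Wasserstein distance is $W_p(X,Y)=\big(\inf_\gamma\sum_{x\in X}d(x,\gamma(x))^p\big)^{1/p}$ over all bijections $\gamma:X\to Y$. The symmetry defect of $X$ with respect to an isometry $\pi$ is $\mu(X,\pi)=\big(\inf_{\gamma\neq\pi|_X}\sum_{x\in X}d(x,\gamma(x))^p\big)^{1/p}$, the infimum being over all bijections $\gamma:X\to\pi(X)$ other than the restriction $\pi|_X$. *)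

(* Defs.v *)
From HB Require Import structures.
From mathcomp Require Import all_boot all_order all_algebra finmap.
From mathcomp Require Import all_classical all_reals all_analysis.
Set Implicit Arguments.
Unset Strict Implicit.
Unset Printing Implicit Defensive.
Import Order.TTheory GRing.Theory Num.Theory.
Local Open Scope classical_set_scope.
Local Open Scope fset_scope.
Local Open Scope ring_scope.

(* The canonical norm on 'rV[R]_k is the sup norm, hence an explicit
   Euclidean distance. *)
Definition eucl_dist {R : realType} {k : nat} (x y : 'rV[R]_k) : R :=
  Num.sqrt (\sum_(i < k) (x 0 i - y 0 i) ^+ 2).

Definition Iso {R : realType} {k : nat} : set ('rV[R]_k -> 'rV[R]_k) :=
  [set f | bijective f /\ forall x y, eucl_dist (f x) (f y) = eucl_dist x y].

Definition Conf {R : realType} {k : nat} (n : nat) : set {fset 'rV[R]_k} :=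
  [set X | #|` X| = n].

Section Matchings.
Context {R : realType} {k : nat}.
Implicit Types (X Y : {fset 'rV[R]_k}) (f : 'rV[R]_k -> 'rV[R]_k) (p : R).

Definition cost p X Y (g : X -> Y) : R :=
  \sum_(x : X) eucl_dist (val x) (val (g x)) `^ p.

Definition wasserstein p X Y : R :=
  inf [set cost p g | g in [set g : X -> Y | bijective g]] `^ p^-1.

Definition restr f X (x : X) : [fset f y | y in X] :=
  FSetSub (in_imfset imfset_key f (fsvalP x)).

Definition symdefect p X f : R :=
  inf [set cost p g | g in [set g : X -> [fset f y | y in X] |
                              bijective g /\ g <> @restr f X]] `^ p^-1.

End Matchings.

(* Main.v *)
Require Import Defs.
From mathcomp Require Import all_boot all_order all_algebra finmap.
From mathcomp Require Import all_classical all_reals all_analysis.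
From mathcomp Require Import perm.
Local Open Scope ring_scope.
Import Order.TTheory GRing.Theory Num.Theory.

(** Call f the isometry, and let s : X -> Y be a bijection realizing W_p(X,Y);
it exists because there are finitely many bijections.  Conjugation by s turns
a bijection g : Y -> f(Y) into the bijection h : X -> f(X) given by
h = f s^-1 f^-1 g s, where f s^-1 f^-1 : f(Y) -> f(X) is the transport of s^-1
by f.  As conjugation is injective and sends f|_Y to f|_X, competitors for
mu(Y,f) become competitors for mu(X,f).

For x in X, the path x, s x, g (s x), h x gives
  d(x, h x) <= d(x, s x) + d(s x, g (s x)) + d(g (s x), h x).
Summing p-th powers over x, the first term gives the cost of s.  The second
one gives the cost of g, after reindexing by s.  The third one gives the cost
of s again: with z = s^-1 f^-1 g (s x) it is d(f (s z), f z) = d(s z, z), and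
z runs over X when x does.  Minkowski's inequality for finite sums then yields
  mu(X,f) <= mu(Y,f) + 2 W_p(X,Y)
when g is optimal ([symdefect_le_add]), and exchanging X and Y, with s^-1 in
place of s, gives the other half.

Minkowski's inequality ([minkowski_sum]) comes from the convexity of the power
function; with exponent 2 it also gives the triangle inequality for the
Euclidean distance. *)

Lemma powR_convex_combination {R : realType} (p t x y : R) :
  1 <= p -> 0 <= t <= 1 -> 0 <= x -> 0 <= y ->
  (t * x + (1 - t) * y) `^ p <= t * x `^ p + (1 - t) * y `^ p.
Proof.
move=> p1 /andP[t0 t1] x0 y0.
have := @convex_powR R p p1 (Itv01 t0 t1) x y.
by rewrite !inE /= !in_itv/= x0 y0 => /(_ isT isT).
Qed.

(** With t = A / (A + B), each (a i + b i) / (A + B) is the convex combination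
of a i / A and b i / B with weights t and 1 - t, so convexity of the power
function bounds the normalized sum by t + (1 - t) = 1.  The bounds A and B are
separate from the norms of a and b, so that they can be taken positive even
when one of the norms vanishes. *)
Lemma minkowski_bound {R : realType} {I : finType} (p A B : R) (a b : I -> R) :
  1 <= p -> 0 < A -> 0 < B -> (forall i, 0 <= a i) -> (forall i, 0 <= b i) ->
  \sum_i a i `^ p <= A `^ p -> \sum_i b i `^ p <= B `^ p ->
  \sum_i (a i + b i) `^ p <= (A + B) `^ p.
Proof.
move=> p1 A0 B0 a0 b0 leA leB.
have AB0 : 0 < A + B by exact: addr_gt0.
pose t := A / (A + B).
have t0 : 0 <= t by rewrite divr_ge0 ?ltW.
have t1 : t <= 1 by rewrite ler_pdivrMr// mul1r lerDl ltW.
have ABn0 : A + B != 0 by rewrite gt_eqF.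
have t1E : 1 - t = B / (A + B).
  by rewrite /t -[X in X - _](divff ABn0) -mulrBl addrAC subrr add0r.
have rescale (c C : R) : 0 < C -> (A + B) * (C / (A + B) * (c / C)) = c.
  move=> C0; rewrite mulrA [X in X * _]mulrCA divff// mulr1 mulrCA.
  by rewrite divff ?gt_eqF// mulr1.
have abE i : a i + b i = (A + B) * (t * (a i / A) + (1 - t) * (b i / B)).
  by rewrite mulrDr t1E !rescale.
have normalized (c : I -> R) C : 0 < C -> (forall i, 0 <= c i) ->
    \sum_i c i `^ p <= C `^ p -> \sum_i (c i / C) `^ p <= 1.
  move=> C0 c0 leC; under eq_bigr do rewrite powRM ?invr_ge0 ?(ltW C0)//.
  rewrite -mulr_suml -powR_inv1 ?(ltW C0)// powRAC powR_inv1 ?powR_ge0//.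
  by rewrite ler_pdivrMr ?powR_gt0// mul1r.
apply: (@le_trans _ _ (\sum_i (A + B) `^ p *
    (t * (a i / A) `^ p + (1 - t) * (b i / B) `^ p))).
  apply: ler_sum => i _; rewrite abE powRM ?(ltW AB0)//; last first.
    by rewrite addr_ge0// mulr_ge0// ?subr_ge0// divr_ge0// ltW.
  rewrite ler_pM2l ?powR_gt0//.
  by apply: powR_convex_combination; rewrite ?t0 ?divr_ge0 ?(ltW A0) ?(ltW B0).
rewrite -mulr_sumr ger_pMr ?powR_gt0// big_split/= -!mulr_sumr.
rewrite -[leRHS](subrK t) addrC lerD//.
  by rewrite ler_piMr ?subr_ge0 ?normalized.
by rewrite ler_piMr ?normalized.
Qed.

Lemma powRK {R : realType} (p x : R) : 0 < p -> 0 <= x -> (x `^ p) `^ p^-1 = x.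
Proof. by move=> p0 x0; rewrite -powRrM mulfV ?gt_eqF// powRr1. Qed.

Lemma powRVK {R : realType} (p x : R) : 0 < p -> 0 <= x -> (x `^ p^-1) `^ p = x.
Proof. by move=> p0 x0; rewrite powRAC powRK. Qed.

Lemma ler_powRV {R : realType} (p x y : R) :
  0 < p -> 0 <= x -> x <= y -> x `^ p^-1 <= y `^ p^-1.
Proof.
move=> p0 x0 xy; rewrite ge0_ler_powR ?invr_ge0 ?(ltW p0) ?nnegrE//.
exact: le_trans xy.
Qed.

(** Each norm is enlarged by e / 2 to get the positive bounds that
[minkowski_bound] requires, and e is arbitrary. *)
Lemma minkowski_sum {R : realType} {I : finType} (p : R) (a b : I -> R) :
  1 <= p -> (forall i, 0 <= a i) -> (forall i, 0 <= b i) ->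
  (\sum_i (a i + b i) `^ p) `^ p^-1 <=
  (\sum_i a i `^ p) `^ p^-1 + (\sum_i b i `^ p) `^ p^-1.
Proof.
move=> p1 a0 b0; have p0 : 0 < p := lt_le_trans ltr01 p1.
have sum0 (c : I -> R) : 0 <= \sum_i c i `^ p.
  by apply: sumr_ge0 => i _; exact: powR_ge0.
have enlarge (c : I -> R) (e : R) : 0 < e ->
    \sum_i c i `^ p <= ((\sum_i c i `^ p) `^ p^-1 + e) `^ p.
  move=> e0; rewrite -[leLHS](powRVK p)//.
  by rewrite ge0_ler_powR ?nnegrE ?addr_ge0 ?powR_ge0 ?lerDl ?ltW.
apply/ler_addgt0Pr => e e0; have e20 : 0 < e / 2 by rewrite divr_gt0.
rewrite [e in leRHS]splitr addrACA.
rewrite -[leRHS](powRK p)//; last by rewrite !addr_ge0 ?powR_ge0 ?ltW.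
apply: ler_powRV => //.
by apply: minkowski_bound => //; rewrite ?ltr_wpDl ?powR_ge0 ?enlarge.
Qed.

Lemma eucl_dist_ge0 {R : realType} {k : nat} (x y : 'rV[R]_k) :
  0 <= eucl_dist x y.
Proof. exact: sqrtr_ge0. Qed.

Lemma eucl_distC {R : realType} {k : nat} (x y : 'rV[R]_k) :
  eucl_dist x y = eucl_dist y x.
Proof. by congr Num.sqrt; apply: eq_bigr => i _; rewrite -sqrrN opprB. Qed.

(** Minkowski's inequality with exponent 2, applied to the absolute values of
the coordinate differences. *)
Lemma eucl_dist_triangle {R : realType} {k : nat} (y x z : 'rV[R]_k) :
  eucl_dist x z <= eucl_dist x y + eucl_dist y z.
Proof.
have distE (u v : 'rV[R]_k) :
    eucl_dist u v = (\sum_i `|u 0 i - v 0 i| `^ 2) `^ 2^-1.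
  rewrite powR12_sqrt; last by apply: sumr_ge0 => i _; exact: powR_ge0.
  congr Num.sqrt; apply: eq_bigr => i _.
  by rewrite (powR_mulrn 2)// real_normK ?num_real.
rewrite !distE; apply: le_trans (@minkowski_sum R _ 2 _ _ _ _ _) => //; last first.
  by rewrite ler1n.
apply: ler_powRV => //; first by apply: sumr_ge0 => i _; exact: powR_ge0.
apply: ler_sum => i _; rewrite ge0_ler_powR ?nnegrE ?addr_ge0//.
by rewrite -[x 0 i - _](subrKA (y 0 i)) ler_normD.
Qed.

(** Between finite types there are finitely many functions, so the infimum is
a minimum over the finite type of finite functions. *)
Lemma inf_image_attained {R : realType} {T U : finType}
    (P : set (T -> U)) (F : (T -> U) -> R) :
  (P !=set0)%classic -> exists2 g, P g & inf (F @` P)%classic = F g.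
Proof.
move=> [g0 Pg0].
have funE (g : T -> U) : fun_of_fin (finfun g) = g.
  by apply/funext => x; rewrite ffunE.
have Q0 : `[< P (fun_of_fin (finfun g0)) >] by apply/asboolP; rewrite funE.
have [g /asboolP Pg minF] := @Order.TotalTheory.arg_minP _ _ {ffun T -> U}
  (finfun g0) (fun h => `[< P (fun_of_fin h) >]) (fun h => F h) Q0.
have lbF : lbound (F @` P)%classic (F g).
  by move=> _ [h Ph <-]; rewrite -(funE h); apply: minF; rewrite funE; apply/asboolP.
exists (g : T -> U) => //; apply/eqP; rewrite eq_le; apply/andP; split.
  by apply: ge_inf; [exists (F g) | exists (g : T -> U)].
by apply: lb_le_inf => //; exists (F g), (g : T -> U).
Qed.

Section Matchings.
Context {R : realType} {k : nat}.
Implicit Types (X Y : {fset 'rV[R]_k}) (f : 'rV[R]_k -> 'rV[R]_k) (p : R).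

Lemma cost_ge0 p X Y (g : X -> Y) : 0 <= cost p g.
Proof. by apply: sumr_ge0 => x _; exact: powR_ge0. Qed.

Lemma cost_inv p X Y (g : X -> Y) (h : Y -> X) :
  cancel g h -> cancel h g -> cost p h = cost p g.
Proof.
move=> gK hK; rewrite /cost (reindex g) /=; last by exists h => y _.
by apply: eq_bigr => x _; rewrite gK eucl_distC.
Qed.

Lemma restr_bij f X : injective f -> bijective (restr f (X := X)).
Proof.
move=> injf; have injr : injective (restr f (X := X)).
  by move=> x y /(congr1 val) /injf /val_inj.
apply: inj_card_bij => //.
by rewrite -!cardfE card_imfset.
Qed.

(** Exchange the images of two points.  Without a competitor, the symmetry
defect would be an infimum over the empty set. *)
Lemma exists_bij_neq_restr f X : injective f -> (2 <= #|` X|)%N ->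
  exists g : X -> [fset f y | y in X]%fset, bijective g /\ g <> restr f (X := X).
Proof.
move=> injf; rewrite cardfE => /card_gt1P[a [b [_ _ ab]]].
exists (restr f (X := X) \o tperm a b); split.
  by apply: bij_comp; [exact: restr_bij | exists (tperm a b); exact: tpermK].
move=> /(congr1 (fun g => g a)) /=; rewrite tpermL.
by move=> /(bij_inj (restr_bij _ _ injf)) ba; rewrite ba eqxx in ab.
Qed.

(** The core estimate.  It is stated for an arbitrary bijection s, given with
its inverse t, so that it also applies with the roles of s and t exchanged. *)
Lemma symdefect_le_add p X Y f (s : X -> Y) (t : Y -> X) :
  1 <= p -> Iso f -> (2 <= #|` Y|)%N -> cancel s t -> cancel t s ->
  symdefect p X f <= symdefect p Y f + 2 * cost p s `^ p^-1.
Proof.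
move=> p1 [/bij_inj injf isof] Y2 sK tK.
have p0 : 0 < p := lt_le_trans ltr01 p1.
have [g [bijg gNf] infE] := inf_image_attained _ (@cost R k p _ _)
  (exists_bij_neq_restr _ _ injf Y2).
rewrite {2}/symdefect infE.
have [r rK restrK] := restr_bij _ Y injf.
(* r inverts f on Y, so this is g conjugated by s and its transport by f. *)
pose h : X -> [fset f y | y in X]%fset := restr f (X := X) \o t \o r \o g \o s.
have bijh : bijective h.
  apply: bij_comp; last by exists t.
  apply: bij_comp => //; apply: bij_comp; last by exists (restr f (X := Y)).
  by apply: bij_comp; [exact: restr_bij | exists s].
have hNf : h <> restr f (X := X).
  move=> hE; apply: gNf; apply/funext => y.
  have /(bij_inj (restr_bij _ _ injf)) : h (t y) = restr f (t y) by rewrite hE.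
  by rewrite /= tK => /(can_inj tK) rE; rewrite -[in RHS]rE restrK.
have le_cost : symdefect p X f <= cost p h `^ p^-1.
  apply: ler_powRV => //.
    by apply: lb_le_inf; [exists (cost p h), h | move=> _ [? _ <-]; exact: cost_ge0].
  apply: ge_inf; last by exists h.
  by exists 0 => _ [? _ <-]; exact: cost_ge0.
apply: le_trans le_cost _.
pose d1 x := eucl_dist (val x) (val (s x)).
pose d2 x := eucl_dist (val (s x)) (val (g (s x))).
pose d3 x := eucl_dist (val (g (s x))) (val (h x)).
have sum2 : \sum_x d2 x `^ p = cost p g.
  by rewrite /cost [RHS](reindex s)//; exists t => y _.
(* Reindex by z = t (r (g (s x))): then h x = f z and g (s x) = f (s z), and f
   preserves distances. *)
have sum3 : \sum_x d3 x `^ p = cost p s.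
  have bij_rgs : bijective (t \o r \o g \o s).
    apply: bij_comp; last by exists t.
    by apply: bij_comp => //; apply: bij_comp; [exists s | exists (restr f (X := Y))].
  rewrite /cost [RHS](reindex (t \o r \o g \o s))/=; last exact: onW_bij.
  apply: eq_bigr => x _; rewrite /d3 tK /h /= eucl_distC.
  by rewrite -{2}(restrK (g (s x))) isof.
have -> : cost p g `^ p^-1 + 2 * cost p s `^ p^-1 =
    cost p s `^ p^-1 + (cost p g `^ p^-1 + cost p s `^ p^-1).
  by rewrite mulr_natl mulr2n addrCA.
have split_le : cost p h `^ p^-1 <=
    (\sum_x (d1 x + (d2 x + d3 x)) `^ p) `^ p^-1.
  apply: ler_powRV => //; first exact: cost_ge0.
  apply: ler_sum => x _.
  rewrite ge0_ler_powR ?nnegrE ?addr_ge0 ?eucl_dist_ge0 ?(ltW p0)//.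
  apply: le_trans (eucl_dist_triangle (val (s x)) _ _) _; rewrite lerD2l.
  exact: eucl_dist_triangle.
apply: le_trans split_le _.
apply: le_trans (minkowski_sum _ _ _ p1 _ _) _ => [x|x|].
- exact: eucl_dist_ge0.
- by rewrite addr_ge0 ?eucl_dist_ge0.
rewrite lerD2l -sum2 -sum3.
by apply: minkowski_sum => // x; exact: eucl_dist_ge0.
Qed.

End Matchings.

Theorem theorem2p3p8 (R : realType) (n k : nat) (p : R)
    (hn : (2 <= n)%N) (hp : 1 <= p)
    (X Y : {fset 'rV[R]_k}) (hX : Conf n X) (hY : Conf n Y)
    (f : 'rV[R]_k -> 'rV[R]_k) (hf : Iso f) :
  `| symdefect p X f - symdefect p Y f | <= 2 * wasserstein p X Y.
Proof.
have cardXY : #|{: X}| = #|{: Y}| by rewrite -!cardfE hX hY.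
(* The enumerations of X and Y give a first bijection, so that the infimum
   defining the Wasserstein distance is attained. *)
have [|s [t sK tK] infE] := @inf_image_attained R X Y
    [set g : X -> Y | bijective g]%classic (@cost R k p X Y).
  exists (fun x => enum_val (cast_ord cardXY (enum_rank x))) => /=.
  apply: inj_card_bij; last by rewrite cardXY.
  by move=> x y /enum_val_inj /cast_ord_inj /enum_rank_inj.
rewrite /wasserstein infE ler_distl lerBlDr; apply/andP; split.
  rewrite -(cost_inv _ _ _ _ _ sK tK).
  by apply: symdefect_le_add tK sK => //; rewrite hX.
by apply: symdefect_le_add sK tK => //; rewrite hY.
Qed.
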